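(* For every nonnegative integer $n$, $$\sum_{k=0}^{n} \left( -\frac{1}{4} \right)^{k} \binom{n}{k} \binom{2k}{k} O_{k} = -\left( \frac{1}{4} \right)^{n} \binom{2n}{n} O_{n}.$$
   Context: $O_r = 1 + \frac{1}{3} + \cdots + \frac{1}{2r-1}$ denotes the $r$-th odd harmonic number (with $O_0 = 0$). *)

(* Defs.v *)
From mathcomp Require Import all_boot all_order all_algebra.

Set Implicit Arguments.
Unset Strict Implicit.
Unset Printing Implicit Defensive.

Import GRing.Theory.
Local Open Scope ring_scope.

Definition odd_harmonic (r : nat) : rat :=
  \sum_(i < r) 1 / (2 * i + 1)%:R.

(* Main.v *)
Require Import Defs.
From mathcomp Require Import all_boot all_order all_algebra.
From mathcomp Require Import ring zify.

Set Implicit Arguments.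
Unset Strict Implicit.
Unset Printing Implicit Defensive.

Import GRing.Theory.
Local Open Scope ring_scope.

(** The identity is the derivative at x = 1/2 of the Chu-Vandermonde identity
    sum_k (-1)^k C(n, k) M(x, k) = M(1 - x, n), where
    M(x, k) = x (x + 1) ... (x + k - 1) / k!.
    Indeed M(1/2, k) = (1/4)^k C(2k, k), and the logarithmic derivative of
    M(x, k) at 1/2 is the sum over i < k of 1 / (1/2 + i), that is, 2 O_k
    ([multichoose_half], [deriv_multichoose_half]); the point 1/2 is fixed by
    x |-> 1 - x, whose derivative -1 is the sign on the right-hand side.

    Chu-Vandermonde itself follows from Pascal's rule for M: each increment of
    n replaces M(x, k) by M(x, k) - M(x, k + 1) = - M(x - 1, k + 1), so the
    alternating sum reduces to a single term [multichoose_diff], which the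
    reflection [multichoose_reflect] turns into M(1 - x, n). *)

(** The base point a is itself a polynomial: translation and reflection of the
    argument are then ring operations on a, with no polynomial composition, and
    formal differentiation is available. *)
Definition multichoose (a : {poly rat}) (k : nat) : {poly rat} :=
  \prod_(i < k) ((i.+1%:R^-1)%:P * (a + i%:R)).

Lemma multichoose0 a : multichoose a 0 = 1.
Proof. by rewrite /multichoose big_ord0. Qed.

Lemma multichooseS a k :
  multichoose a k.+1 = multichoose a k * ((k.+1%:R^-1)%:P * (a + k%:R)).
Proof. by rewrite /multichoose big_ord_recr. Qed.

Lemma polyC_natVK k : (k.+1%:R^-1)%:P * k.+1%:R = 1 :> {poly rat}.
Proof. by rewrite -polyC_natr -polyCM mulVf // Num.Theory.pnatr_eq0. Qed.

(** Both sides are the same product a - 1, a, ..., a + k - 1 over (k + 1)!, with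
    the first factor singled out on the right instead of the last one. *)
Lemma multichoose_shift a k :
  multichoose (a - 1) k.+1 = (k.+1%:R^-1)%:P * (a - 1) * multichoose a k.
Proof.
elim: k => [|k IHk]; first by rewrite multichooseS !multichoose0; ring.
rewrite multichooseS IHk multichooseS -[X in a - 1 + X]natr1; ring.
Qed.

Lemma multichoose_pascal a k :
  multichoose a k - multichoose a k.+1 = - multichoose (a - 1) k.+1.
Proof.
rewrite multichoose_shift multichooseS.
have {1}-> : multichoose a k = (k.+1%:R^-1)%:P * k.+1%:R * multichoose a k.
  by rewrite polyC_natVK mul1r.
rewrite -[X in _ * X * _ - _]natr1; ring.
Qed.

(** The offset m makes the induction on n close: Pascal's rule for C(n + 1, k)
    and the one for multichoose together trade (n + 1, m, a) for
    (n, m + 1, a - 1), up to sign. *)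
Lemma multichoose_diff n m a :
  \sum_(0 <= k < n.+1) (-1) ^+ k * 'C(n, k)%:R * multichoose a (k + m)
  = (-1) ^+ n * multichoose (a - n%:R) (n + m).
Proof.
elim: n m a => [|n IHn] m a.
  by rewrite big_nat1 bin0 mulr1 subr0.
rewrite big_nat_recl // bin0.
under eq_bigr => k _ do rewrite binS natrD mulrDr mulrDl.
rewrite big_split /=.
(* Reindexing drops the term at 0; the top term vanishes as C(n, n + 1) = 0. *)
have -> : \sum_(0 <= k < n.+1)
    (-1) ^+ k.+1 * 'C(n, k.+1)%:R * multichoose a (k.+1 + m)
  = \sum_(0 <= k < n.+1) (-1) ^+ k * 'C(n, k)%:R * multichoose a (k + m)
    - multichoose a m.
  rewrite [in LHS]big_nat_recr //= bin_small // mulr0 mul0r addr0.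
  by rewrite [in RHS]big_nat_recl //= bin0; ring.
rewrite expr0 mulr1 mul1r add0n addrA addrCA subrr addr0 -big_split /=.
have -> : a - n.+1%:R = a - 1 - n%:R by rewrite -natr1; ring.
rewrite addSnnS exprS -mulrA -IHn mulr_sumr; apply: eq_bigr => k _.
rewrite addSn addnS -[RHS]mulrCA -[RHS]mulrA mulN1r -multichoose_pascal.
by rewrite exprS; ring.
Qed.

Lemma multichoose_reflect n a :
  (-1) ^+ n * multichoose (a - n%:R) n = multichoose (1 - a) n.
Proof.
elim: n => [|n IHn]; first by rewrite !multichoose0 mulr1.
have -> : a - n.+1%:R = a - n%:R - 1 by rewrite -natr1; ring.
rewrite multichoose_shift multichooseS -IHn exprS; ring.
Qed.

Lemma chu_vandermonde n a :
  \sum_(0 <= k < n.+1) (-1) ^+ k * 'C(n, k)%:R * multichoose a k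
  = multichoose (1 - a) n.
Proof.
have := multichoose_diff n 0 a; rewrite addn0 multichoose_reflect => <-.
by apply: eq_bigr => k _; rewrite addn0.
Qed.

Lemma central_binS k :
  ('C(2 * k.+1, k.+1) * k.+1 = 2 * (2 * k + 1) * 'C(2 * k, k))%N.
Proof.
have diag := mul_bin_diag (2 * k).+2 k.
have down := mul_bin_down (2 * k).+1 k.
have succ_bottom : ((2 * k).+1 - k = k.+1)%N by lia.
rewrite /= in diag; rewrite succ_bottom /= in down.
have -> : (2 * k.+1 = (2 * k).+2)%N by lia.
by rewrite mulnC -diag; nia.
Qed.

Definition scaled_central_bin (k : nat) : rat := (1 / 4) ^+ k * 'C(2 * k, k)%:R.

Lemma scaled_central_binS k :
  scaled_central_bin k.+1
  = scaled_central_bin k * (k.+1%:R^-1 * (1 / 2 + k%:R)).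
Proof.
have kn0 : k.+1%:R != 0 :> rat by rewrite Num.Theory.pnatr_eq0.
apply: (mulIf kn0); rewrite /scaled_central_bin -mulrA -natrM central_binS.
rewrite !natrM natrD natrM exprS; field.
by rewrite addrC natr1.
Qed.

Lemma odd_harmonicS k :
  odd_harmonic k.+1 = odd_harmonic k + 1 / (2 * k + 1)%:R.
Proof. by rewrite /odd_harmonic big_ord_recr. Qed.

Lemma multichoose_half (a : {poly rat}) (t : rat) k :
  a.[t] = 1 / 2 -> (multichoose a k).[t] = scaled_central_bin k.
Proof.
move=> at_half; elim: k => [|k IHk].
  by rewrite multichoose0 hornerC /scaled_central_bin bin0 mulr1.
by rewrite multichooseS scaled_central_binS -polyC_natr !hornerE IHk at_half.
Qed.

(** Each factor a + i of the product contributes a' / (1/2 + i) = 2 a' / (2i + 1)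
    to the logarithmic derivative. *)
Lemma deriv_multichoose_half (a : {poly rat}) (t : rat) k :
  a.[t] = 1 / 2 ->
  (multichoose a k)^`().[t]
  = 2 * a^`().[t] * (scaled_central_bin k * odd_harmonic k).
Proof.
move=> at_half; elim: k => [|k IHk].
  by rewrite multichoose0 derivC horner0 /odd_harmonic big_ord0 !mulr0.
rewrite multichooseS scaled_central_binS odd_harmonicS -polyC_natr.
rewrite derivM derivM derivD !derivC mul0r add0r addr0.
rewrite !(hornerD, hornerM, hornerC) IHk (multichoose_half _ at_half) at_half.
have half_n0 : 2 * k%:R + 1 != 0 :> rat.
  by rewrite -natrM natr1 Num.Theory.pnatr_eq0.
rewrite natrD natrM.
have k1n0 : k.+1%:R != 0 :> rat by rewrite Num.Theory.pnatr_eq0.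
move: (scaled_central_bin k) (k.+1%:R : rat) k1n0 => c d d_n0.
field.
by rewrite half_n0 d_n0.
Qed.

Theorem theorem1 (n : nat) :
  \sum_(0 <= k < n.+1)
     (- (1 / 4) : rat) ^+ k * 'C(n, k)%:R * 'C(2 * k, k)%:R * odd_harmonic k
  = - ((1 / 4) ^+ n * 'C(2 * n, n)%:R * odd_harmonic n).
Proof.
have X_half : 'X.[1 / 2 : rat] = 1 / 2 by rewrite hornerX.
have XC_half : (1 - 'X).[1 / 2 : rat] = 1 / 2 by rewrite !hornerE; field.
have := congr1 (fun p : {poly rat} => p^`().[1 / 2]) (chu_vandermonde n 'X).
rewrite /= (deriv_multichoose_half _ XC_half) raddf_sum /= horner_sum.
rewrite derivB derivX derivC sub0r hornerN hornerC => derivative_eq.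
(* The 2 of 1 / (1/2 + i) = 2 / (2i + 1) is common to both sides. *)
apply: (@mulfI _ (2 : rat)) => //.
rewrite -/(scaled_central_bin n).
transitivity (2 * -1 * (scaled_central_bin n * odd_harmonic n)); last by ring.
rewrite -derivative_eq mulr_sumr; apply: eq_bigr => k _.
have -> : (-1) ^+ k * 'C(n, k)%:R * multichoose 'X k
    = ((-1) ^+ k * 'C(n, k)%:R)%:P * multichoose 'X k :> {poly rat}.
  by rewrite polyCM polyC_exp polyCN polyC_natr.
rewrite derivM derivC mul0r add0r hornerM hornerC.
rewrite (deriv_multichoose_half _ X_half) derivX hornerC /scaled_central_bin.
rewrite -[- (1 / 4)]mulN1r exprMn; ring.
Qed.
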